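(* The initial conditions $$B_j^1(q)=1\ \text{ for } j\ge 1,\qquad B_j^j(q)=(1-q^2)\cdots(1-q^j)\ \text{ for } j\ge 2,$$ and the recurrence relation $$B_j^k(q)=B_{j-1}^k(q)+(1-q^j)B_{j-1}^{k-1}(q)-B_{j-2}^{k-1}(q)\qquad(2\le k\le j-1)$$ define a unique family of polynomials $(B_j^k)_{1\le k\le j}$ in the variable $q$, with integer coefficients. These polynomials satisfy $B_j^k(0)=1$. Moreover, for all integers $1\le j\le n$, $$a_n^j=\sum_{k=1}^{j}q^{j-k+1}B_j^k(q)\,a_{n-k}.$$
   Context: Superscripts in $B_j^k$ and $a_n^j$ are indices, not exponents. For a positive integer $n$, $W(A_n)$ is the Coxeter group with generators $\sigma_1,\dots,\sigma_n$ and relations $\sigma_i^2=1$, $\sigma_i\sigma_{i+1}\sigma_i=\sigma_{i+1}\sigma_i\sigma_{i+1}$ for $1\le i\le n-1$, and $\sigma_i\sigma_j=\sigma_j\sigma_i$ for $|i-j|\ge 2$; $W(A_0)=1$. The length $l(w)$ is the minimal number of generators in an expression of $w$; expressions of this length are called reduced. An element is fully commutative if any of its reduced expressions can be obtained from any other by applying only commutation relations $\sigma_i\sigma_j=\sigma_j\sigma_i$, $|i-j|\ge2$; $W^c(A_n)$ is the set of fully commutative elements of $W(A_n)$. Put $a_n=\sum_{w\in W^c(A_n)}q^{l(w)}$, with $a_0=1$. For $1\le i\le j\le n$ let $\lceil i,j\rceil=\sigma_i\sigma_{i+1}\cdots\sigma_j$. By a known result of Stembridge, $W^c(A_n)$ is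 the set of elements given by the normal form $$\lceil i_1,j_1\rceil\lceil i_2,j_2\rceil\cdots\lceil i_p,j_p\rceil,\quad 0\le p\le n,\ n\ge j_1>\cdots>j_p\ge1,\ n\ge i_1>\cdots>i_p\ge 1,\ j_t\ge i_t\ (1\le t\le p)$$ (each fully commutative element has exactly one such normal form, and it is a reduced expression). For $1\le j\le n$, $A_n^j$ is the set of $w\in W^c(A_n)$ whose normal form has $p\ge 1$ and $j_p=j$ (i.e. ends with $\sigma_j$ on the right), and $a_n^j=\sum_{w\in A_n^j}q^{l(w)}$. *)

(* Defs.v *)
From HB Require Import structures.
From mathcomp Require Import all_boot all_order all_algebra generic_quotient.
From mathcomp Require Import boolp classical_sets fsbigop.

Set Implicit Arguments.
Unset Strict Implicit.
Unset Printing Implicit Defensive.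

Import GRing.Theory.

Local Open Scope quotient_scope.

(* Words in the Coxeter generators of type A_n. The letter i : 'I_n stands for
   sigma_(i+1), so the letters are sigma_1, ..., sigma_n. *)
Definition word (n : nat) := seq 'I_n.

(* The congruence on words generated by the Coxeter relations. As the
   generators are involutions, the quotient monoid is already the group
   presented by these relations. *)
Inductive coxeter_eq (n : nat) : word n -> word n -> Prop :=
| CoxRefl s : coxeter_eq s s
| CoxSym s t : coxeter_eq s t -> coxeter_eq t s
| CoxTrans s t u : coxeter_eq s t -> coxeter_eq t u -> coxeter_eq s u
| CoxSquare u v (i : 'I_n) : coxeter_eq (u ++ [:: i; i] ++ v) (u ++ v)
| CoxBraid u v (i j : 'I_n) : j = i.+1 :> nat ->
    coxeter_eq (u ++ [:: i; j; i] ++ v) (u ++ [:: j; i; j] ++ v)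
| CoxComm u v (i j : 'I_n) : i.+1 < j ->
    coxeter_eq (u ++ [:: i; j] ++ v) (u ++ [:: j; i] ++ v).

Inductive commutation_eq (n : nat) : word n -> word n -> Prop :=
| CommRefl s : commutation_eq s s
| CommSym s t : commutation_eq s t -> commutation_eq t s
| CommTrans s t u :
    commutation_eq s t -> commutation_eq t u -> commutation_eq s u
| CommSwap u v (i j : 'I_n) : i.+1 < j ->
    commutation_eq (u ++ [:: i; j] ++ v) (u ++ [:: j; i] ++ v).

Definition coxeter_rel (n : nat) : rel (word n) :=
  fun s t => `[< coxeter_eq s t >].

Lemma coxeter_rel_refl n : reflexive (@coxeter_rel n).
Proof. by move=> s; apply/asboolP; exact: CoxRefl. Qed.

Lemma coxeter_rel_sym n : symmetric (@coxeter_rel n).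
Proof. by move=> s t; apply/asboolP/asboolP => h; exact: CoxSym. Qed.

Lemma coxeter_rel_trans n : transitive (@coxeter_rel n).
Proof.
move=> t s u /asboolP st /asboolP tu; apply/asboolP; exact: CoxTrans st tu.
Qed.

Canonical coxeter_equiv n := EquivRel (@coxeter_rel n)
  (@coxeter_rel_refl n) (@coxeter_rel_sym n) (@coxeter_rel_trans n).

(* The Coxeter group W(A_n). *)
Definition W (n : nat) := {eq_quot coxeter_equiv n}.

HB.instance Definition _ n := Choice.copy (W n) {eq_quot coxeter_equiv n}.


Lemma W_eqP n (s t : word n) :
  \pi_(W n) s = \pi_(W n) t <-> coxeter_eq s t.
Proof.
by split=> [/eqmodP/asboolP//|h]; apply/eqmodP; apply/asboolP.
Qed.

Lemma coxeter_eq_ctx n (u v s t : word n) :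
  coxeter_eq s t -> coxeter_eq (u ++ s ++ v) (u ++ t ++ v).
Proof.
elim=> {s t} [s|s t _|s t r _ st _ tr|a b i|a b i j ij|a b i j ij].
- exact: CoxRefl.
- exact: CoxSym.
- exact: CoxTrans st tr.
- by have := CoxSquare (u ++ a) (b ++ v) i; rewrite -!catA.
- by have := CoxBraid (u ++ a) (b ++ v) ij; rewrite -!catA.
- by have := CoxComm (u ++ a) (b ++ v) ij; rewrite -!catA.
Qed.

Lemma coxeter_eq_cat n (s s' t t' : word n) :
  coxeter_eq s s' -> coxeter_eq t t' -> coxeter_eq (s ++ t) (s' ++ t').
Proof.
move=> hs ht; apply: (CoxTrans (t := s' ++ t)).
  exact: (coxeter_eq_ctx [::] t hs).
by have := coxeter_eq_ctx s' [::] ht; rewrite !cats0.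
Qed.

Lemma coxeter_eq_rev n (s t : word n) :
  coxeter_eq s t -> coxeter_eq (rev s) (rev t).
Proof.
elim=> {s t} [s|s t _|s t r _ st _ tr|a b i|a b i j ij|a b i j ij].
- exact: CoxRefl.
- exact: CoxSym.
- exact: CoxTrans st tr.
- by rewrite !rev_cat -catA; exact: CoxSquare.
- by rewrite !rev_cat -!catA; exact: CoxBraid.
- by rewrite !rev_cat -!catA; apply: CoxSym; exact: CoxComm.
Qed.

Lemma coxeter_eq_rev_cat n (s : word n) : coxeter_eq (rev s ++ s) [::].
Proof.
elim: s => [|i s IHs]; first exact: CoxRefl.
rewrite rev_cons cat_rcons; apply: CoxTrans IHs.
exact: (CoxSquare (rev s) s i).
Qed.

Definition W_one n : W n := \pi_(W n) [::].
Definition W_mul n (x y : W n) : W n := \pi_(W n) (repr x ++ repr y).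
Definition W_inv n (x : W n) : W n := \pi_(W n) (rev (repr x)).

Lemma repr_pi n (s : word n) : coxeter_eq (repr (\pi_(W n) s)) s.
Proof. by apply/W_eqP; rewrite reprK. Qed.

Lemma W_mul_pi n (s t : word n) :
  W_mul (\pi_(W n) s) (\pi_(W n) t) = \pi_(W n) (s ++ t).
Proof. by apply/W_eqP; apply: coxeter_eq_cat; exact: repr_pi. Qed.

Lemma W_inv_pi n (s : word n) : W_inv (\pi_(W n) s) = \pi_(W n) (rev s).
Proof. by apply/W_eqP; apply: coxeter_eq_rev; exact: repr_pi. Qed.

Lemma W_ind n (P : W n -> Prop) : (forall s, P (\pi_(W n) s)) -> forall x, P x.
Proof. by move=> h x; have := h (repr x); rewrite reprK. Qed.

Lemma W_mulA n : associative (@W_mul n).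
Proof.
by elim/W_ind=> s; elim/W_ind=> t; elim/W_ind=> u; rewrite !W_mul_pi catA.
Qed.

Lemma W_1mul n : left_id (W_one n) (@W_mul n).
Proof. by elim/W_ind=> s; rewrite W_mul_pi. Qed.

Lemma W_mul1 n : right_id (W_one n) (@W_mul n).
Proof. by elim/W_ind=> s; rewrite W_mul_pi cats0. Qed.

Lemma W_mulV n : left_inverse (W_one n) (@W_inv n) (@W_mul n).
Proof.
elim/W_ind=> s; rewrite W_inv_pi W_mul_pi; apply/W_eqP.
exact: coxeter_eq_rev_cat.
Qed.

Lemma W_Vmul n : right_inverse (W_one n) (@W_inv n) (@W_mul n).
Proof.
elim/W_ind=> s; rewrite W_inv_pi W_mul_pi; apply/W_eqP.
by have := coxeter_eq_rev_cat (rev s); rewrite revK.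
Qed.

HB.instance Definition _ n := isGroup.Build (W n)
  (@W_mulA n) (@W_1mul n) (@W_mul1 n) (@W_mulV n) (@W_Vmul n).

Definition sigma (n : nat) (i : 'I_n) : W n := \pi_(W n) [:: i].

Definition word_prod (n : nat) (s : word n) : W n :=
  (\prod_(i <- s) sigma i)%g.

Lemma word_prodE n (s : word n) : word_prod s = \pi_(W n) s.
Proof.
rewrite /word_prod; elim: s => [|i s IHs]; first by rewrite big_nil.
by rewrite big_cons IHs; exact: W_mul_pi.
Qed.

Lemma ex_word_size n (w : W n) :
  exists k, `[< exists2 s : word n, word_prod s = w & size s = k >].
Proof.
exists (size (repr w)); apply/asboolP; exists (repr w) => //.
by rewrite word_prodE reprK.
Qed.

Definition len (n : nat) (w : W n) : nat := ex_minn (ex_word_size w).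

Definition reduced_expr (n : nat) (w : W n) (s : word n) : Prop :=
  word_prod s = w /\ size s = len w.

Definition fully_commutative (n : nat) (w : W n) : Prop :=
  forall s t, reduced_expr w s -> reduced_expr w t -> commutation_eq s t.

Definition Wc (n : nat) : set (W n) := [set w | fully_commutative w]%classic.
Arguments Wc : clear implicits.

(* Here and below {poly int} is Z[q], with 'X for q. The sums over sets are
   finitely supported sums; they are the actual sums because W(A_n) is
   finite. *)
Definition a (n : nat) : {poly int} :=
  (\sum_(w \in Wc n) ('X^(len w) : {poly int}))%R.

Definition block (n : nat) (i j : 'I_n) : W n :=
  (\prod_(k < n | (i <= k <= j)%N) sigma k)%g.

(* The list of pairs [:: (i_1, j_1); ...; (i_p, j_p)] of a normal form, with
   indices shifted by one as for the letters of words. *)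
Definition normal_form (n : nat) (s : seq ('I_n * 'I_n)) : bool :=
  [&& size s <= n,
      sorted (fun x y : 'I_n * 'I_n => y.2 < x.2) s,
      sorted (fun x y : 'I_n * 'I_n => y.1 < x.1) s
    & all (fun x : 'I_n * 'I_n => x.1 <= x.2) s].

Definition nf_prod (n : nat) (s : seq ('I_n * 'I_n)) : W n :=
  (\prod_(x <- s) block x.1 x.2)%g.

Definition A (n j : nat) : set (W n) :=
  [set w | Wc n w /\ exists s (x : 'I_n * 'I_n),
     [/\ normal_form (rcons s x), w = nf_prod (rcons s x) & x.2.+1 = j]]%classic.
Arguments A : clear implicits.

Definition aj (n j : nat) : {poly int} :=
  (\sum_(w \in A n j) ('X^(len w) : {poly int}))%R.

(* B j k is B_j^k; only the values with 1 <= k <= j are constrained. *)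
Definition B_spec (B : nat -> nat -> {poly int}) : Prop :=
  [/\ forall j, 1 <= j -> B j 1 = 1%R,
      forall j, 2 <= j -> B j j = (\prod_(2 <= i < j.+1) (1 - 'X^i))%R
    & forall j k, 2 <= k <= j - 1 ->
        B j k = (B (j - 1)%N k + (1 - 'X^j) * B (j - 1)%N (k - 1)%N
                 - B (j - 2)%N (k - 1)%N)%R].

(* Main.v *)
Require Import Defs.
From mathcomp Require Import all_boot all_order all_algebra generic_quotient.
From mathcomp Require Import zify ring.
From mathcomp Require Import boolp classical_sets fsbigop.

Set Implicit Arguments.
Unset Strict Implicit.
Unset Printing Implicit Defensive.

Import GRing.Theory.

Local Open Scope quotient_scope.

(** Fully commutative elements are counted through their normal forms.

    Normal forms.  Adding one letter on the right of a normal form word and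
    sorting by commutations either gives a normal form word again or exposes a
    factor [ii] or [iji] with [|i - j| = 1] ([nf_insert]).  A reduced word of a
    fully commutative element can contain neither up to commutations: [ii] can
    be shortened, and applying the braid relation to [iji] changes the multiset
    of letters, which commutations preserve.  So every fully commutative element
    has a normal form ([fc_nf]).

    The converse uses the permutations of [{0, ..., n}].  Their depth, the sum
    of [pos v - v] over the values [v] moved to the right, grows by at most
    [1] per letter and by at most [2] over a factor [iji].  Hence it bounds the
    length of a word from below, strictly when the word contains a forbidden
    factor ([depth_le], [depth_non_fc]).  In a normal form with blocks
    [(i_t, j_t)], the value [i_t] ends in position [j_t + 1] and no other value
    moves to the right ([pos_nf]), so the depth is exactly the length of the
    word and the blocks can be read off the permutation.  Therefore normal form
    words are reduced, no reduced word of such an element contains a forbidden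
    factor, and distinct normal forms give distinct fully commutative elements.

    Generating functions.  Split the normal forms whose last block ends at
    [j + 1] by the start of that block: if it is not the first generator, shift
    all indices down by one; otherwise remove the block, which leaves a shifted
    normal form all of whose blocks end after [j].  This gives [aj_rec],
    [a_{n+1}^{j+1} = a_n^j + q^{j+1} (a_n - a_n^1 - ... - a_n^j)].  The formula
    then follows by induction on [n]: comparing the coefficients of [a_{n-k}]
    leaves
    [B_{j+1}^{k+1} = B_j^k - sum_{k <= l <= j} q^{l+1} B_l^k],
    and this summed form of the recurrence is taken as the definition of the
    family ([diagB]): the recurrence of [B_spec] is the difference of two
    consecutive instances of it. *)

(** * Words up to commutation *)

Lemma comm_eq_ctx n (u v s t : word n) :
  commutation_eq s t -> commutation_eq (u ++ s ++ v) (u ++ t ++ v).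
Proof.
elim=> {s t} [s|s t _|s t r _ st _ tr|a b i j ij].
- exact: CommRefl.
- exact: CommSym.
- exact: CommTrans st tr.
- by have := CommSwap (u ++ a) (b ++ v) ij; rewrite -!catA.
Qed.

Lemma comm_eq_catr n (v s t : word n) :
  commutation_eq s t -> commutation_eq (s ++ v) (t ++ v).
Proof. exact: (comm_eq_ctx [::]). Qed.

Lemma comm_eq_catl n (u s t : word n) :
  commutation_eq s t -> commutation_eq (u ++ s) (u ++ t).
Proof. by move/(comm_eq_ctx u [::]); rewrite !cats0. Qed.

Lemma coxeter_of_comm n (s t : word n) : commutation_eq s t -> coxeter_eq s t.
Proof.
elim=> {s t} [s|s t _|s t r _ st _ tr|a b i j ij].
- exact: CoxRefl.
- exact: CoxSym.
- exact: CoxTrans st tr.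
- exact: CoxComm.
Qed.

Lemma perm_of_comm n (s t : word n) : commutation_eq s t -> perm_eq s t.
Proof.
elim=> {s t} [s|s t _|s t r _ st _ tr|a b i j ij] //.
- by rewrite perm_sym.
- exact: perm_trans st tr.
- by rewrite perm_cat2l perm_cat2r; apply/permP=> p /=; lia.
Qed.

Lemma size_of_comm n (s t : word n) : commutation_eq s t -> size s = size t.
Proof. by move/perm_of_comm/perm_size. Qed.

Definition far n (k x : 'I_n) := (x.+1 < k) || (k.+1 < x).

Lemma comm_eq_far n (k : 'I_n) (s : word n) :
  all (far k) s -> commutation_eq (s ++ [:: k]) (k :: s).
Proof.
elim: s => [|x s IHs] /=; first by move=> _; exact: CommRefl.
case/andP=> kx /IHs h.
apply: (CommTrans (comm_eq_catl [:: x] h)).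
case/orP: kx => [xk|kx]; first exact: (CommSwap [::] s xk).
apply: CommSym; exact: (CommSwap [::] s kx).
Qed.

(** The two kinds of factor that no reduced word of a fully commutative element
    may have. *)
Inductive collapsing n : word n -> Prop :=
| CollapseSquare (i : 'I_n) : collapsing [:: i; i]
| CollapseBraid (i j : 'I_n) : (j == i.+1 :> nat) || (i == j.+1 :> nat) ->
    collapsing [:: i; j; i].

Definition non_fc n (s : word n) :=
  exists u p v, collapsing p /\ commutation_eq s (u ++ p ++ v).

Lemma non_fc_comm n (s t : word n) : commutation_eq s t -> non_fc t -> non_fc s.
Proof.
move=> st [u [p [v [hp h]]]]; exists u, p, v; split=> //; exact: CommTrans st h.
Qed.

Lemma non_fc_catr n (s t : word n) : non_fc s -> non_fc (s ++ t).
Proof.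
case=> u [p [v [hp h]]]; exists u, p, (v ++ t); split=> //.
by have := comm_eq_catr t h; rewrite -!catA.
Qed.

(** * Normal form words *)

(** The bounds are natural numbers, with the upper one excluded, so that
    concatenation and the empty run need no boundary conditions. *)
Definition run n (a b : nat) : word n := [seq k : 'I_n <- enum 'I_n | a <= k < b].

Lemma mem_run n a b (k : 'I_n) : (k \in run n a b) = (a <= k < b).
Proof. by rewrite mem_filter mem_enum andbT. Qed.

Lemma val_run n a b : b <= n -> map val (run n a b) = iota a (b - a).
Proof.
move=> bn; apply: (irr_sorted_eq ltn_trans ltnn).
- rewrite sorted_map; apply: sorted_filter; first by move=> ???; exact: ltn_trans.
  by rewrite -sorted_map val_enum_ord iota_ltn_sorted.
- exact: iota_ltn_sorted.
move=> x; rewrite mem_iota; apply/mapP/idP=> [[k]|h].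
  rewrite mem_run => ? -> /=; lia.
have xn : x < n by lia.
by exists (Ordinal xn) => //; rewrite mem_run /=; lia.
Qed.

Lemma size_run n a b : b <= n -> size (run n a b) = b - a.
Proof. by move=> bn; rewrite -(size_map val) val_run // size_iota. Qed.

Lemma run_cat n a m b : a <= m <= b -> b <= n ->
  run n a b = run n a m ++ run n m b.
Proof.
move=> amb bn; apply: (inj_map val_inj); rewrite map_cat !val_run //; last by lia.
have -> : b - a = (m - a) + (b - m) by lia.
by rewrite iotaD subnKC //; lia.
Qed.

Lemma run1 n (k : 'I_n) : run n k k.+1 = [:: k].
Proof.
apply: (inj_map val_inj); rewrite val_run //.
by have -> : k.+1 - k = 1 by lia.
Qed.

Lemma run_nil n a : run n a a = [::].
Proof.
rewrite /run (eq_filter (a2 := pred0)) ?filter_pred0 // => k /=; lia.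
Qed.

Lemma runSr n a (k : 'I_n) : a <= k -> run n a k.+1 = run n a k ++ [:: k].
Proof. by move=> ak; rewrite (@run_cat n a k) ?run1 //; lia. Qed.

(** The condition for the block [x] to stand somewhere to the left of the block
    [y]; it is transitive, so consecutive blocks may be replaced by all pairs. *)
Definition left_of (x y : nat * nat) := (y.1 < x.1) && (y.2 < x.2).

(** Blocks are pairs of natural numbers rather than of ordinals: passing between
    the ranks [n] and [n.+1] is then a mere translation. *)
Definition nf (n : nat) (s : seq (nat * nat)) :=
  pairwise left_of s && all (fun x => x.1 <= x.2 < n) s.

Definition nf_word n (s : seq (nat * nat)) : word n :=
  flatten [seq run n x.1 x.2.+1 | x <- s].

Lemma nf_rcons n s x :
  nf n (rcons s x) = [&& all (left_of^~ x) s, nf n s & x.1 <= x.2 < n].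
Proof.
rewrite /nf pairwise_rcons all_rcons.
by case: (all _ _); case: (pairwise _ _);
  rewrite ?andbF /= ?andbT ?(andbC (all _ _)) ?andbF.
Qed.

Lemma nf_word_rcons n s x :
  nf_word n (rcons s x) = nf_word n s ++ run n x.1 x.2.+1.
Proof. by rewrite /nf_word map_rcons flatten_rcons. Qed.

(** The letter [k] is compared with the last block [(i, j)].  If [k > j + 1] it
    commutes with that block and the induction hypothesis applies to the rest;
    if [k = j + 1] it extends the block, unless the preceding block already ends
    at [k], and then [k j k] appears; if [i <= k <= j] it meets the [k] of the
    block in [k (k+1) k], or [k k]; and if [k < i] it is a new block.  The last
    clause of the conclusion lets the block [(i, j)] be put back to the right of
    the new normal form in the first case. *)
Lemma nf_insert n s (k : 'I_n) : nf n s ->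
  non_fc (nf_word n s ++ [:: k]) \/
  exists s', [/\ nf n s', commutation_eq (nf_word n s ++ [:: k]) (nf_word n s')
    & forall y : nat * nat, y.1 < k -> y.2 < k ->
        all (left_of^~ y) s -> all (left_of^~ y) s'].
Proof.
have app_single s0 : nf n s0 -> all (left_of^~ (val k, val k)) s0 -> exists s',
  [/\ nf n s', commutation_eq (nf_word n s0 ++ [:: k]) (nf_word n s')
    & forall y : nat * nat, y.1 < k -> y.2 < k ->
        all (left_of^~ y) s0 -> all (left_of^~ y) s'].
  move=> nfs0 hs0; exists (rcons s0 (val k, val k)); split.
  - by rewrite nf_rcons hs0 nfs0 leqnn ltn_ord.
  - by rewrite nf_word_rcons /= run1; exact: CommRefl.
  - by move=> y y1 y2 ys; rewrite all_rcons ys andbT /left_of /= y1 y2.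
elim/last_ind: s => [|s [i j] IHs]; first by right; exact: app_single.
move=> nfx; move: (nfx); rewrite nf_rcons => /and3P[/= hs nfs /andP[ij jn]].
rewrite nf_word_rcons /=.
case: (ltngtP k j.+1) => [kj|jk|kj].
- case: (ltnP k i) => [ki|ik].
    right; rewrite -[_ ++ run _ _ _](nf_word_rcons n s (i, j)).
    apply: app_single => //; rewrite all_rcons /left_of /= ki /=.
    rewrite (leq_trans ki ij) /=; apply: sub_all hs => x /andP[/= h1 h2].
    by apply/andP; split=> /=; lia.
  left; rewrite -catA; case: (ltnP k j) => [kltj|jlek].
    have kn : k.+1 < n by lia.
    exists (nf_word n s ++ run n i k), [:: k; Ordinal kn; k], (run n k.+2 j.+1).
    split; first by apply: CollapseBraid; rewrite eqxx.
    rewrite (@run_cat n i k) ?(@run_cat n k k.+1 j.+1); try by lia.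
    rewrite run1 (@run_cat n k.+1 k.+2 j.+1); try by lia.
    have -> := run1 (Ordinal kn); rewrite -!catA /=.
    do 2 apply: comm_eq_catl; apply: (comm_eq_catl [:: k; Ordinal kn]).
    apply: comm_eq_far; apply/allP=> x; rewrite mem_run /far; lia.
  have jE : j = k by lia.
  exists (nf_word n s ++ run n i k), [:: k; k], [::]; split.
    exact: CollapseSquare.
  by rewrite jE runSr // -!catA; exact: CommRefl.
- have far_run : all (far k) (run n i j.+1).
    by apply/allP=> x; rewrite mem_run /far; lia.
  have swap : commutation_eq ((nf_word n s ++ run n i j.+1) ++ [:: k])
                ((nf_word n s ++ [:: k]) ++ run n i j.+1).
    by rewrite -!catA; apply: comm_eq_catl; exact: comm_eq_far.
  case: (IHs nfs) => [bad|[s' [nfs' ss' hs']]].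
    by left; apply: non_fc_comm swap _; exact: non_fc_catr.
  right; exists (rcons s' (i, j)); split.
  + rewrite nf_rcons nfs' ij jn !andbT; apply: hs' hs => /=; lia.
  + by rewrite nf_word_rcons; apply: CommTrans swap _; exact: comm_eq_catr.
  + by move=> y y1 y2; rewrite !all_rcons => /andP[-> /hs' ->].
have [j' j'E] : exists j' : 'I_n, j = j' by exists (Ordinal jn).
case: (boolP (all (fun x => k < x.2) s)) => [ks|].
  right; exists (rcons s (i, val k)); split.
  - rewrite nf_rcons nfs ltn_ord andbT /=; apply/andP; split; last by lia.
    apply/allP=> x xs; move: (allP hs x xs) (allP ks x xs).
    by rewrite /left_of /= => /andP[-> _].
  - rewrite nf_word_rcons /= runSr; last by lia.
    by rewrite kj catA; exact: CommRefl.
  - move=> y y1 y2; rewrite !all_rcons => /andP[/andP[/= h1 h2] ->].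
    by rewrite /left_of /= h1 y2.
case/lastP: s hs nfs {IHs nfx} => // s z; rewrite all_rcons nf_rcons.
case/andP=> /andP[/= iz jz] _ /and3P[hz _ /andP[z12 _]].
move=> hk; have zk : z.2 = k.
  apply/eqP; rewrite eqn_leq kj jz andbT -kj leqNgt; apply: contra hk => kz.
  rewrite all_rcons kz; apply: sub_all hz => x /andP[_]; exact: ltn_trans.
left; rewrite nf_word_rcons zk.
rewrite (@runSr n z.1); last by lia.
rewrite j'E runSr -?j'E //.
exists (nf_word n s ++ run n z.1 k ++ run n i j), [:: k; j'; k], [::].
split; first by apply: CollapseBraid; lia.
have h : commutation_eq ([:: k] ++ run n i j) (run n i j ++ [:: k]).
  apply: CommSym; apply: comm_eq_far; apply/allP=> x; rewrite mem_run /far; lia.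
by have := comm_eq_ctx (nf_word n s ++ run n z.1 k) [:: j'; k] h;
  rewrite j'E cats0 -!catA.
Qed.

Lemma non_fc_or_nf n (t : word n) :
  non_fc t \/ exists2 s, nf n s & commutation_eq t (nf_word n s).
Proof.
elim/last_ind: t => [|t k IHt].
  by right; exists [::] => //; exact: CommRefl.
rewrite -cats1; case: IHt => [bad|[s nfs ts]].
  by left; exact: non_fc_catr.
have tsk := comm_eq_catr [:: k] ts.
case: (nf_insert k nfs) => [bad|[s' [nfs' ss' _]]].
  by left; exact: non_fc_comm tsk bad.
by right; exists s' => //; exact: CommTrans tsk ss'.
Qed.

(** * The permutation of a word and its depth *)

Definition adj_swap (k x : nat) :=
  if x == k then k.+1 else if x == k.+1 then k else x.

(** The final position of the value [v] when the letters of [s], from left to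
    right, exchange the contents of adjacent positions. *)
Definition pos n (s : word n) (v : nat) :=
  foldl (fun x (k : 'I_n) => adj_swap k x) v s.

Lemma pos_cat n (s t : word n) v : pos (s ++ t) v = pos t (pos s v).
Proof. exact: foldl_cat. Qed.

(* Innermost conditions first: the outer ones depend on them. *)
Ltac case_ifs :=
  repeat match goal with |- context [if ?b then _ else _] =>
    lazymatch b with
    | context [if _ then _ else _] => fail
    | _ => case: (boolP b) => ?
    end
  end.

Lemma adj_swapK k : involutive (adj_swap k).
Proof. by move=> x; rewrite /adj_swap; case_ifs; lia. Qed.

Lemma pos_inj n (s : word n) : injective (pos s).
Proof.
elim: s => [|k s IHs] x y //= /IHs; exact: can_inj (@adj_swapK k) x y.
Qed.

Lemma pos_coxeter n (s t : word n) : coxeter_eq s t -> pos s =1 pos t.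
Proof.
elim=> {s t} [s|s t _ st|s t r _ st _ tr|u v i|u v i j ij|u v i j ij] x //.
- by rewrite st tr.
- by rewrite !pos_cat /= adj_swapK.
- by rewrite !pos_cat /=; congr pos; rewrite /adj_swap; case_ifs; lia.
- by rewrite !pos_cat /=; congr pos; rewrite /adj_swap; case_ifs; lia.
Qed.

Lemma pos_run n i j x : i <= j <= n ->
  pos (run n i j) x = if x == i then j else if i < x <= j then x.-1 else x.
Proof.
move=> /andP[ij]; elim: j ij => [|j IHj].
  by rewrite leqn0 => /eqP-> _; rewrite run_nil /=; case_ifs; lia.
rewrite leq_eqVlt => /predU1P[<- _|ij jn]; first by rewrite run_nil /=; case_ifs; lia.
have -> := @runSr n i (Ordinal jn) ij.
rewrite pos_cat IHj //=; last by lia.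
rewrite /adj_swap; case_ifs; lia.
Qed.

(** The truncated subtraction keeps only the values that end to the right of
    where they started; this is half the total displacement of the
    permutation. *)
Definition depth n (s : word n) := \sum_(v < n.+1) (pos s v - v).

(** Only one value sits in position [k] after [s], so if [t] moves just the
    content of [k] to the right, and by at most [c], then the depth gains at
    most [c]. *)
Lemma depth_catr n (s t : word n) k c :
    (forall x, pos t x <= x + c * (x == k)) ->
  depth (s ++ t) <= depth s + c.
Proof.
move=> ht; apply: (@leq_trans (\sum_(v < n.+1) ((pos s v - v) + c * (pos s v == k)))).
  apply: leq_sum => v _; rewrite pos_cat.
  by move: (ht (pos s v)); lia.
rewrite big_split leq_add2l -big_distrr /= -[leqRHS]muln1 leq_mul2l.
apply/orP; right; rewrite -big_mkcond /= sum1_card.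
apply/card_le1_eqP => v w /eqP vk /eqP wk.
by apply/val_inj/(@pos_inj n s); rewrite vk wk.
Qed.

Lemma depth_cat n (s t : word n) : depth (s ++ t) <= depth s + size t.
Proof.
elim/last_ind: t => [|t k IHt]; first by rewrite cats0 addn0.
rewrite size_rcons addnS -addn1 -cats1 catA.
apply: (@leq_trans (depth (s ++ t) + 1)); last by rewrite leq_add2r.
by apply: (@depth_catr _ _ _ k) => x /=; rewrite /adj_swap; case_ifs; lia.
Qed.

Lemma depth_le n (s : word n) : depth s <= size s.
Proof.
have := depth_cat [::] s; rewrite /= {2}/depth big1 // => v _ /=; exact: subnn.
Qed.

(** A factor [iji] acts as an exchange of two positions at distance [2]: the only
    content that it moves to the right moves by [2], although it has three
    letters.  A factor [ii] moves nothing. *)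
Lemma depth_collapsing n (s p : word n) :
  collapsing p -> depth (s ++ p) < depth s + size p.
Proof.
case=> [i|i j ij] /=.
  rewrite addnS ltnS; apply: (@depth_catr _ _ _ i) => x /=.
  by rewrite adj_swapK; lia.
rewrite addnS ltnS; apply: (@depth_catr _ _ _ (minn i j)) => x /=.
rewrite /adj_swap; case_ifs; lia.
Qed.

Lemma depth_coxeter n (s t : word n) : coxeter_eq s t -> depth s = depth t.
Proof. by move=> st; apply: eq_bigr => v _; rewrite (pos_coxeter st). Qed.

Lemma depth_non_fc n (s : word n) : non_fc s -> depth s < size s.
Proof.
case=> u [p [v [hp h]]].
rewrite (depth_coxeter (coxeter_of_comm h)) (size_of_comm h) catA.
apply: (leq_ltn_trans (depth_cat _ _)).
have := depth_collapsing u hp; have := depth_le u; rewrite !size_cat; lia.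
Qed.

(** The blocks to the left of [(i, j)] only touch positions greater than [i], so
    [i] is still in place when the block [(i, j)] carries it to position [j + 1];
    everything else in its way moves one step to the left.  Blocks further
    right act on positions up to [j] only, so [i] stays there. *)
Lemma pos_nf n s : nf n s ->
  [/\ forall x, x \in s -> pos (nf_word n s) x.1 = x.2.+1,
      forall v, v \notin unzip1 s -> pos (nf_word n s) v <= v
    & forall v, all (fun x => v < x.1) s -> pos (nf_word n s) v = v].
Proof.
elim/last_ind: s => [|s [i j] IHs]; first by [].
rewrite nf_rcons => /and3P[/allP hs /IHs[h1 h2 h3] /andP[/= ij jn]].
have pos_i : pos (nf_word n s) i = i.
  by apply: h3; apply/allP=> x /hs /andP[].
have posE v : pos (nf_word n (rcons s (i, j))) v =
    let x := pos (nf_word n s) v in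
    if x == i then j.+1 else if i < x <= j.+1 then x.-1 else x.
  by rewrite nf_word_rcons pos_cat pos_run //= leqW.
split=> [x|v|v].
- rewrite mem_rcons inE => /predU1P[-> /=|xs].
    by rewrite posE /= pos_i eqxx.
  by rewrite posE /= h1 //; move/hs: xs => /andP[/= ? ?]; case_ifs; lia.
- rewrite /unzip1 map_rcons mem_rcons inE /= negb_or => /andP[vi /h2 hv].
  have : pos (nf_word n s) v != i.
    by rewrite -[X in _ != X]pos_i (inj_eq (@pos_inj _ _)).
  by rewrite posE /=; case_ifs; lia.
- by rewrite all_rcons => /andP[/= vi /h3 hv]; rewrite posE /= hv; case_ifs; lia.
Qed.

Definition weight (s : seq (nat * nat)) := \sum_(x <- s) (x.2.+1 - x.1).

Lemma size_nf_word n s : nf n s -> size (nf_word n s) = weight s.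
Proof.
case/andP=> _ /allP hs; rewrite /nf_word size_flatten /shape -map_comp sumnE big_map.
by apply: eq_big_seq => x /hs /andP[_ xn] /=; rewrite size_run.
Qed.

Lemma nf_uniq1 n s : nf n s -> uniq (unzip1 s).
Proof.
case/andP=> hs _; apply: (@sorted_uniq _ gtn); first exact/rev_trans/ltn_trans.
  exact: ltnn.
apply: pairwise_sorted; rewrite pairwise_map.
by apply: sub_pairwise hs => x y /andP[].
Qed.

Lemma depth_nf n s : nf n s -> depth (nf_word n s) = size (nf_word n s).
Proof.
move=> nfs; rewrite size_nf_word // /depth.
rewrite -(big_mkord xpredT (fun v => pos (nf_word n s) v - v)).
have [h1 h2 _] := pos_nf nfs.
rewrite (bigID (mem (unzip1 s))) /= [X in _ + X]big1 ?addn0; last first.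
  by move=> v /h2; rewrite -subn_eq0 => /eqP.
rewrite -big_filter (perm_big (unzip1 s)); last first.
  apply: uniq_perm; rewrite ?filter_uniq ?iota_uniq ?(nf_uniq1 nfs) // => v.
  rewrite mem_filter mem_index_iota /= andbC; apply: andb_idl.
  by case/mapP=> x xs ->; case/andP: nfs => _ /allP/(_ x xs); lia.
by rewrite /unzip1 big_map; apply: eq_big_seq => x /h1 ->.
Qed.

(** The blocks are the pairs [(v, pos v - 1)] with [pos v > v], and their order
    is imposed. *)
Lemma pos_nf_inj n s t : nf n s -> nf n t ->
  pos (nf_word n s) =1 pos (nf_word n t) -> s = t.
Proof.
have lt_tr : transitive left_of.
  by move=> y x z /andP[? ?] /andP[? ?]; apply/andP; lia.
have sub s1 s2 : nf n s1 -> nf n s2 ->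
    pos (nf_word n s1) =1 pos (nf_word n s2) -> {subset s1 <= s2}.
  move=> nf1 nf2 e [i j] xs; have [h1 _ _] := pos_nf nf1.
  have [h2 h3 _] := pos_nf nf2.
  have := h1 _ xs; rewrite e /= => ej.
  have : i \in unzip1 s2.
    apply: contraT => /h3; rewrite ej.
    by case/andP: nf1 => _ /allP/(_ _ xs) /=; lia.
  case/mapP=> -[i' j'] ys /= ii'; move: (h2 _ ys); rewrite /= -ii' ej => -[->].
  by rewrite ii'.
move=> nfs nft e; apply: (irr_sorted_eq lt_tr).
- by move=> x; rewrite /left_of ltnn.
- by case/andP: nfs => /pairwise_sorted.
- by case/andP: nft => /pairwise_sorted.
by move=> x; apply/idP/idP; apply: sub => // v; rewrite e.
Qed.

(** * Normal forms and fully commutative elements *)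

Lemma len_le n (t : word n) : len (\pi_(W n) t) <= size t.
Proof.
rewrite /len; case: ex_minnP => m _; apply; apply/asboolP.
by exists t => //; rewrite word_prodE.
Qed.

Lemma ex_reduced n (w : W n) : exists s, reduced_expr w s.
Proof.
rewrite /reduced_expr /len; case: ex_minnP => m /asboolP[s sw sm] _.
by exists s.
Qed.

Lemma reduced_coxeter n (w : W n) (s t : word n) :
  reduced_expr w s -> \pi_(W n) t = w -> coxeter_eq s t.
Proof. by case=> + _ tw; rewrite word_prodE -tw => /W_eqP. Qed.

Definition nf_elt n (s : seq (nat * nat)) : W n := \pi_(W n) (nf_word n s).

(** The depth depends only on the element and is at most the size of any of its
    words; the normal form word attains it. *)
Lemma len_nf n s : nf n s -> len (nf_elt n s) = size (nf_word n s).
Proof.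
move=> nfs; apply/eqP; rewrite eqn_leq len_le /=.
have [t ht] := ex_reduced (nf_elt n s).
rewrite -(proj2 ht) -(depth_nf nfs) -(depth_coxeter (reduced_coxeter ht erefl)).
exact: depth_le.
Qed.

Lemma nf_elt_inj n s t : nf n s -> nf n t -> nf_elt n s = nf_elt n t -> s = t.
Proof.
by move=> nfs nft /W_eqP/pos_coxeter; exact: pos_nf_inj.
Qed.

(** Every reduced word of the element has size equal to its depth, hence sorts
    to a normal form word, which is the given one by injectivity. *)
Lemma nf_elt_fc n s : nf n s -> fully_commutative (nf_elt n s).
Proof.
move=> nfs; suff to_nf t : reduced_expr (nf_elt n s) t ->
    commutation_eq t (nf_word n s).
  by move=> t u /to_nf ht /to_nf hu; exact: CommTrans ht (CommSym hu).
move=> ht; have ts := reduced_coxeter ht erefl.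
case: (non_fc_or_nf t) => [/depth_non_fc|[s' nfs' ts']].
  by rewrite (depth_coxeter ts) (depth_nf nfs) (proj2 ht) len_nf // ltnn.
suff -> : s = s' by [].
apply: (@nf_elt_inj n) => //; apply/W_eqP.
exact: CoxTrans (CoxSym ts) (coxeter_of_comm ts').
Qed.

(** A square could be deleted, and the braid relation would give a second reduced
    word with other letter multiplicities, whereas commutations preserve them. *)
Lemma reduced_fc n (w : W n) t :
  fully_commutative w -> reduced_expr w t -> ~ non_fc t.
Proof.
move=> fcw tw [u [p [v [hp tp]]]].
have red_p : reduced_expr w (u ++ p ++ v).
  split; last by rewrite -(size_of_comm tp) (proj2 tw).
  rewrite -(proj1 tw) !word_prodE; apply/esym/W_eqP; exact: coxeter_of_comm.
case: hp red_p => [i|i j ij] [pw szp].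
  have : len w <= size (u ++ v).
    rewrite -pw word_prodE.
    have -> : \pi_(W n) (u ++ [:: i; i] ++ v) = \pi_(W n) (u ++ v).
      by apply/W_eqP; exact: CoxSquare.
    exact: len_le.
  rewrite -szp !size_cat /=; lia.
have braid : coxeter_eq (u ++ [:: i; j; i] ++ v) (u ++ [:: j; i; j] ++ v).
  case/orP: ij => /eqP ij; first exact: CoxBraid.
  by apply: CoxSym; exact: CoxBraid.
have red_q : reduced_expr w (u ++ [:: j; i; j] ++ v).
  split; last by rewrite -szp !size_cat.
  by rewrite -pw !word_prodE; apply/esym/W_eqP.
have := perm_of_comm (fcw _ _ (conj pw szp) red_q).
rewrite perm_cat2l perm_cat2r => /permP/(_ (pred1 i)) /=.
have /negbTE -> : j != i by apply/eqP=> e; move: ij; rewrite e; lia.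
by rewrite eqxx.
Qed.

Lemma fc_nf n (w : W n) : fully_commutative w ->
  exists2 s, nf n s & nf_elt n s = w.
Proof.
move=> fcw; have [t tw] := ex_reduced w.
case: (non_fc_or_nf t) => [bad|[s nfs ts]].
  by case: (reduced_fc fcw tw).
exists s => //; rewrite -(proj1 tw) word_prodE; apply/esym/W_eqP.
exact: coxeter_of_comm.
Qed.

Definition nat_blocks n (s : seq ('I_n * 'I_n)) : seq (nat * nat) :=
  [seq (val x.1, val x.2) | x <- s].

Lemma normal_formE n (s : seq ('I_n * 'I_n)) : normal_form s = nf n (nat_blocks s).
Proof.
have pw_sorted (f : 'I_n * 'I_n -> 'I_n) (r : seq ('I_n * 'I_n)) :
    sorted (fun x y => f y < f x) r = pairwise (fun x y => f y < f x) r.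
  by apply: sorted_pairwise => y x z /= h1 h2; exact: ltn_trans h2 h1.
rewrite /normal_form /nf !pw_sorted; apply/and4P/andP.
  case=> _ h2 h1 hs; split.
    by have /andP := conj h1 h2; rewrite -pairwise_relI pairwise_map.
  by rewrite all_map; apply: sub_all hs => x /= ->; exact: ltn_ord.
case; rewrite pairwise_map all_map => hlt hs.
have [h1 h2] : pairwise (fun x y : 'I_n * 'I_n => y.1 < x.1) s /\
               pairwise (fun x y : 'I_n * 'I_n => y.2 < x.2) s.
  by split; apply: sub_pairwise hlt => x y /andP[].
split=> //; last by apply: sub_all hs => x /andP[].
have : uniq (unzip1 s).
  apply: (@pairwise_uniq _ (fun i j : 'I_n => j < i)); first by move=> i; exact: ltnn.
  by rewrite pairwise_map.
by move/card_uniqP; rewrite size_map => <-; rewrite -[leqRHS]card_ord max_card.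
Qed.

Lemma nf_prodE n (s : seq ('I_n * 'I_n)) : nf_prod s = nf_elt n (nat_blocks s).
Proof.
rewrite /nf_prod /nf_elt; elim: s => [|x s IHs]; first by rewrite big_nil.
rewrite big_cons IHs; have -> : block x.1 x.2 = \pi_(W n) (run n x.1 x.2.+1).
  by rewrite -word_prodE /word_prod /run big_filter /block enumT [index_enum _]unlock.
exact: (W_mul_pi (run n x.1 x.2.+1) (nf_word n (nat_blocks s))).
Qed.

Lemma nat_blocks_surj n s : nf n s -> exists s' : seq ('I_n * 'I_n), nat_blocks s' = s.
Proof.
case/andP=> _; elim: s => [|[i j] s IHs]; first by exists [::].
case/andP=> /= /andP[ij jn] /IHs[s' <-].
by exists ((Ordinal (leq_ltn_trans ij jn), Ordinal jn) :: s').
Qed.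

(** * Enumeration of the normal forms *)

(** The index of the last generator of the normal form, generators being
    numbered from [1]; the value [0] stands for the empty normal form. *)
Definition last_end (s : seq (nat * nat)) := last 0 [seq x.2.+1 | x <- s].

Lemma last_end_rcons s x : last_end (rcons s x) = x.2.+1.
Proof. by rewrite /last_end map_rcons last_rcons. Qed.

Definition shift (s : seq (nat * nat)) := [seq (x.1.+1, x.2.+1) | x <- s].

Lemma shift_inj : injective shift.
Proof. by apply: inj_map => -[a b] [c d] [-> ->]. Qed.

Lemma nf_shift n s : nf n.+1 (shift s) = nf n s.
Proof. by rewrite /nf /shift pairwise_map all_map. Qed.

Lemma shiftP n s : nf n s -> all (fun x => 0 < x.1) s -> exists s', s = shift s'.
Proof.
case/andP=> _; elim: s => [|[i j] s IHs]; first by exists [::].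
case/andP=> /= ij /IHs{}IHs /andP[i0 /IHs[s' ->]].
by exists ((i.-1, j.-1) :: s'); rewrite /= !prednK //; lia.
Qed.

(** The ends of the blocks decrease, so the last block decides. *)
Lemma last_end_gt n s j : nf n s ->
  all (fun x => j <= x.2) s = (last_end s == 0) || (j < last_end s).
Proof.
case/lastP: s => [//|s x]; rewrite nf_rcons last_end_rcons all_rcons ltnS /=.
case/and3P=> /allP hs _ _; apply: andb_idr => jx; apply/allP=> y /hs /andP[_].
by move/ltnW; exact: leq_trans.
Qed.

(** A normal form of rank [m.+1] either avoids the first generator, and is a
    translate, or ends with a block [(0, j)] that begins with it; in the latter
    case the blocks before it form a translate of a normal form of rank [m]
    whose ends are at least [j], as the translation adds one to them. *)
Fixpoint nfs n : seq (seq (nat * nat)) :=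
  if n is m.+1 then
    [seq shift s | s <- nfs m] ++
    [seq rcons (shift s) (0, j) | j <- iota 0 m.+1,
       s <- [seq s <- nfs m | (last_end s == 0) || (j < last_end s)]]
  else [:: [::]].

Lemma nfsS n : nfs n.+1 =
  [seq shift s | s <- nfs n] ++
  [seq rcons (shift s) (0, j) | j <- iota 0 n.+1,
     s <- [seq s <- nfs n | (last_end s == 0) || (j < last_end s)]].
Proof. by []. Qed.

Lemma nfs_ends0P n s :
  reflect (exists j s', [/\ j \in iota 0 n.+1,
      s' \in [seq s <- nfs n | (last_end s == 0) || (j < last_end s)]
    & s = rcons (shift s') (0, j)])
  (s \in [seq rcons (shift s) (0, j) | j <- iota 0 n.+1,
     s <- [seq s <- nfs n | (last_end s == 0) || (j < last_end s)]]).
Proof. exact: (@allpairsPdep _ (fun=> _)). Qed.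

Lemma mem_nfs n s : (s \in nfs n) = nf n s.
Proof.
elim: n s => [|n IHn] s.
  by case: s => [|x s] //; rewrite /nf /= ltn0 !andbF.
rewrite nfsS mem_cat; apply/orP/idP => [[/mapP[s' + ->]|/nfs_ends0P[j [s' []]]]|nfs_s].
- by rewrite IHn nf_shift.
- rewrite mem_iota mem_filter IHn => jn /andP[+ nfs'] ->.
  rewrite -(last_end_gt j nfs') nf_rcons nf_shift nfs' /= => hs'; move: jn => /= ->.
  rewrite andbT /shift all_map; apply: sub_all hs' => x.
  by rewrite /left_of /= ltnS.
case: (boolP (all (fun x => 0 < x.1) s)) => [h0|].
  have [s' sE] := shiftP nfs_s h0; left; apply/mapP; exists s' => //.
  by rewrite IHn -nf_shift -sE.
case/lastP: s nfs_s => // s [i j]; rewrite nf_rcons all_rcons => /and3P[hs nfs_s /= ij].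
have pos_s : all (fun x => 0 < x.1) s.
  by apply: sub_all hs => x /andP[/= + _]; exact: leq_ltn_trans.
rewrite pos_s andbT -eqn0Ngt => /eqP i0; right; apply/nfs_ends0P.
have [s' sE] := shiftP nfs_s pos_s; exists j, s'; split.
- by rewrite mem_iota; case/andP: ij.
- have nfs' : nf n s' by rewrite -nf_shift -sE.
  rewrite mem_filter IHn nfs' andbT -(last_end_gt j nfs').
  by move: hs; rewrite sE all_map; apply: sub_all => x /andP[].
- by rewrite sE i0.
Qed.

Lemma nfs_uniq n : uniq (nfs n).
Proof.
elim: n => // n IHn; rewrite nfsS cat_uniq.
rewrite (map_inj_uniq shift_inj) IHn andTb; apply/andP; split.
  apply/hasPn=> _ /nfs_ends0P[j [s [_ _ ->]]]; apply/mapP=> -[s' _ e].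
  have : (0, j) \in shift s' by rewrite -e mem_rcons mem_head.
  by case/mapP.
apply: (@allpairs_uniq_dep _ (fun=> _) _ (fun j s => rcons (shift s) (0, j))).
- exact: (iota_uniq 0 n.+1).
- by move=> j _; exact: filter_uniq.
by move=> [j s] [k t] _ _ /= /rcons_inj[/shift_inj -> ->].
Qed.

Lemma weight_shift s : weight (shift s) = weight s.
Proof. by rewrite /weight big_map. Qed.

Lemma weight_rcons s x : weight (rcons s x) = weight s + (x.2.+1 - x.1).
Proof. by rewrite /weight -cats1 big_cat big_seq1. Qed.

Lemma last_end_shift s j :
  (last_end (shift s) == j.+1) = (0 < j) && (last_end s == j).
Proof.
case/lastP: s => [|s x]; first by case: j.
by rewrite /shift map_rcons !last_end_rcons /= eqSS; case: j.
Qed.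

(** * Generating functions *)

Local Open Scope ring_scope.

Lemma aE n : a n = \sum_(s <- nfs n) 'X^(weight s).
Proof.
rewrite fsbig_seq ?nfs_uniq // /a.
rewrite (@reindex_fsbig _ _ _ _ _ (@nf_elt n) [set` nfs n]%classic).
  by apply: eq_fsbigr => s; rewrite inE /= mem_nfs => h; rewrite len_nf // size_nf_word.
split.
- by move=> s /=; rewrite mem_nfs; exact: nf_elt_fc.
- by move=> s t; rewrite !inE /= !mem_nfs; exact: nf_elt_inj.
- by move=> w /fc_nf[s nfs_s sw]; exists s => //=; rewrite mem_nfs.
Qed.

Lemma ajE n j : (0 < j)%N ->
  aj n j = \sum_(s <- nfs n | last_end s == j) 'X^(weight s).
Proof.
move=> j0; rewrite -big_filter fsbig_seq ?filter_uniq ?nfs_uniq // /aj.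
rewrite (@reindex_fsbig _ _ _ _ _ (@nf_elt n)
  [set` [seq s <- nfs n | last_end s == j]]%classic).
  apply: eq_fsbigr => s; rewrite inE /= mem_filter mem_nfs => /andP[_ h].
  by rewrite len_nf // size_nf_word.
split.
- move=> s /=; rewrite mem_filter mem_nfs => /andP[/eqP lj h].
  split; first exact: nf_elt_fc.
  have [s' s'E] := nat_blocks_surj h; case/lastP: s' s'E => [e|s' x e].
    by move: j0; rewrite -lj -e.
  exists s', x; rewrite normal_formE nf_prodE e; split=> //.
  by rewrite -lj -e /nat_blocks map_rcons last_end_rcons.
- move=> s t; rewrite !inE /= !mem_filter !mem_nfs => /andP[_ ?] /andP[_ ?].
  exact: nf_elt_inj.
- move=> w [_ [s [x []]]]; rewrite normal_formE nf_prodE => h -> xj.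
  exists (nat_blocks (rcons s x)) => //=.
  by rewrite mem_filter mem_nfs h /nat_blocks map_rcons last_end_rcons /= xj eqxx.
Qed.

(** The complementary normal forms are sorted according to their last
    generator. *)
Lemma a_split n j :
  \sum_(s <- nfs n | ((last_end s == 0) || (j < last_end s))%N) 'X^(weight s)
  = a n - \sum_(1 <= l < j.+1) aj n l.
Proof.
rewrite aE [in RHS](bigID (fun s => (last_end s == 0) || (j < last_end s)))%N /=.
rewrite -addrA -[LHS]addr0; congr (_ + _); apply/eqP; rewrite eq_sym subr_eq0.
apply/eqP; rewrite [RHS](eq_big_nat _ _ (fun l hl => ajE n (proj1 (andP hl)))).
under [RHS]eq_bigr do rewrite big_mkcond.
rewrite exchange_big /= big_mkcond; apply: eq_bigr => s _.
rewrite -big_mkcond; case: ifP => hs.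
  rewrite -big_filter (perm_big [:: last_end s]) ?big_seq1 //.
  apply: uniq_perm; rewrite ?filter_uniq ?iota_uniq // => l.
  rewrite mem_filter mem_index_iota inE eq_sym; apply: andb_idr => /eqP->.
  by move: hs; lia.
rewrite big_nat_cond big1 // => l /andP[hl /eqP e].
by move: hs; rewrite e; lia.
Qed.

(** Normal forms of rank [n.+1] are split according to whether their last block
    begins with the first generator.  If [j = 0] it always does. *)
Lemma aj_rec n j : (j <= n)%N ->
  aj n.+1 j.+1 = (if j == 0%N then 0 else aj n j)
    + 'X^(j.+1) * (a n - \sum_(1 <= l < j.+1) aj n l).
Proof.
move=> jn; rewrite ajE // nfsS big_cat big_map; congr (_ + _).
  under eq_bigl do rewrite last_end_shift.
  case: j {jn} => [|j]; first by rewrite big_pred0_eq.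
  by rewrite ajE //; apply: eq_bigr => s _; rewrite weight_shift.
rewrite big_mkcond.
rewrite (@big_allpairs_dep _ _ _ _ (fun=> _) _
  (fun j s => rcons (shift s) (0%N, j))).
rewrite (bigD1_seq j) ?mem_iota ?iota_uniq //= [X in _ + X]big1 ?addr0.
  rewrite -a_split big_distrr big_filter /=; apply: eq_bigr => s _.
  by rewrite last_end_rcons eqxx weight_rcons weight_shift exprD mulrC.
move=> k kj; apply: big1 => s _; rewrite last_end_rcons eqSS.
by rewrite (negbTE kj).
Qed.

(** * The polynomials B *)

(** [diagB k d] is [B_j^{k+1}] for [j = k + 1 + d].  Along this indexing the
    summed recurrence is a structural recursion on [k]. *)
Fixpoint diagB (k d : nat) : {poly int} :=
  if k is l.+1 then
    diagB l d - \sum_(e < d.+1) 'X^((l + e).+2) * diagB l e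
  else 1.

Definition B (j k : nat) : {poly int} := diagB k.-1 (j - k).

Lemma B_specB : B_spec B.
Proof.
split=> [j _|j j2|j k /andP[k2 kj]].
- by [].
- case: j j2 => // j _; rewrite /B subnn /=.
  elim: j => [|j IHj]; first by rewrite big_geq.
  rewrite big_nat_recr // -IHj /= big_ord_recr big_ord0 /= addn0 add0r.
  by rewrite mulrBr mulr1 mulrC.
case: k k2 kj => [|[|k]] // _ kj.
have [d jE] : exists d, j = (k + d).+3 by exists (j - k.+3)%N; lia.
rewrite /B jE.
have -> : ((k + d).+3 - k.+2 = d.+1)%N by lia.
have -> : ((k + d).+3 - 1 - k.+2 = d)%N by lia.
have -> : ((k + d).+3 - 1 - (k.+2 - 1) = d.+1)%N by lia.
have -> : ((k + d).+3 - 2 - (k.+2 - 1) = d)%N by lia.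
have -> : (k.+2 - 1 = k.+1)%N by lia.
rewrite /= (big_ord_recr d.+1) /= addnS.
ring.
Qed.

Lemma B_spec_unique (B1 B2 : nat -> nat -> {poly int}) :
  B_spec B1 -> B_spec B2 -> forall j k, (1 <= k <= j)%N -> B1 j k = B2 j k.
Proof.
move=> [h1 h2 h3] [g1 g2 g3]; elim/ltn_ind=> j IHj k /andP[k1 kj].
have [kE|k_neq1] := eqVneq k 1%N.
  by subst k; rewrite h1 ?g1.
have [kE|k_neqj] := eqVneq k j.
  by subst j; rewrite h2 ?g2 //; clear -k1 k_neq1; lia.
have kj2 : (2 <= k <= j - 1)%N by clear -k1 kj k_neq1 k_neqj; lia.
by rewrite h3 // g3 // !IHj //; clear -kj2; lia.
Qed.

Lemma diagB_at0 k d : (diagB k d).[0] = 1.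
Proof.
elim: k d => [|k IHk] d /=; first by rewrite hornerC.
rewrite hornerD hornerN horner_sum IHk big1 ?subr0 // => e _.
by rewrite hornerM hornerXn expr0n mul0r.
Qed.

(** In terms of [j] and [k] this is the defining equation of [diagB]. *)
Lemma B_succ j k : (0 < k <= j)%N ->
  B j.+1 k.+1 = B j k - \sum_(k <= l < j.+1) 'X^(l.+1) * B l k.
Proof.
case: k => // k /andP[_ kj]; rewrite /B subSS /=; congr (_ - _).
rewrite -[X in \sum_(X <= _ < _) _]add0n big_addn big_mkord.
have -> : (j.+1 - k.+1 = (j - k.+1).+1)%N by lia.
by apply: eq_bigr => e _; rewrite addnK addnS (addnC k).
Qed.

(** By induction on [n]: insert the formulas of rank [n] into [aj_rec], exchange
    the two sums, and recognise [B_succ] in the coefficient of each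
    [a (n - k)]; the term [a n] is the one of index [1] in rank [n.+1]. *)
Lemma aj_formula n j : (1 <= j <= n)%N ->
  aj n j = \sum_(1 <= k < j.+1) 'X^(j - k + 1) * B j k * a (n - k).
Proof.
elim: n j => [|n IHn] [|j] //; rewrite ltnS /= => jn.
rewrite aj_rec //.
have -> : (if j == 0%N then 0 else aj n j) =
    \sum_(1 <= k < j.+1) 'X^(j - k + 1) * B j k * a (n - k).
  by case: eqP => [->|/eqP j0]; [rewrite big_geq|rewrite IHn // lt0n j0].
have -> : \sum_(1 <= l < j.+1) aj n l =
    \sum_(1 <= k < j.+1) (\sum_(k <= l < j.+1) 'X^(l - k + 1) * B l k) * a (n - k).
  (* both indices are given the full range so that the sums can be exchanged *)
  transitivity (\sum_(1 <= l < j.+1) \sum_(1 <= k < j.+1 | (k < l.+1)%N)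
      'X^(l - k + 1) * B l k * a (n - k)).
    apply: eq_big_nat => l /andP[l1 lj]; rewrite IHn; last by lia.
    by rewrite (@big_nat_widen _ _ _ _ _ j.+1).
  rewrite (@exchange_big_dep_nat _ _ _ _ _ _ _ _ _ xpredT) //=.
  apply: eq_big_nat => k /andP[k1 kj].
  by rewrite big_distrl /= [RHS](@big_nat_widenl _ _ _ _ 1%N) //.
(* the comparison of coefficients, after reindexing k as k + 1 on the left *)
have step k : (1 <= k < j.+1)%N ->
    'X^(j.+1 - k.+1 + 1) * B j.+1 k.+1 * a (n - k)
    = 'X^(j - k + 1) * B j k * a (n - k)
      - 'X^(j.+1) * ((\sum_(k <= l < j.+1) 'X^(l - k + 1) * B l k) * a (n - k)).
  move=> kj; rewrite B_succ; last by lia.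
  rewrite subSS mulrBr mulrBl; congr (_ - _); rewrite mulrA; congr (_ * _).
  rewrite !big_distrr /=; apply: eq_big_nat => l kl.
  rewrite !mulrA -!exprD; congr ('X^_ * _); lia.
rewrite [RHS]big_ltn // [in RHS]big_add1 /= subn1.
rewrite (eq_big_nat _ _ step) big_split /= sumrN -big_distrr /= subn1 /=.
rewrite /B /= addn1 mulrBr; ring.
Qed.

Local Close Scope ring_scope.

Theorem proposition2p4 :
  exists B : nat -> nat -> {poly int},
    [/\ B_spec B,
        forall B' : nat -> nat -> {poly int}, B_spec B' ->
          forall j k : nat, (1 <= k <= j)%N -> B' j k = B j k,
        forall j k : nat, (1 <= k <= j)%N -> ((B j k).[0] = 1)%R
      & forall n j : nat, (1 <= j <= n)%N ->
          aj n j = (\sum_(1 <= k < j.+1) 'X^(j - k + 1)%N * B j k * a (n - k)%N)%R].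
Proof.
exists B; split.
- exact: B_specB.
- by move=> B' hB'; exact: B_spec_unique hB' B_specB.
- by move=> j k _; exact: diagB_at0.
- exact: aj_formula.
Qed.
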